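(* Let $f\in H(\mathbb{B})$, $p\ge 1$, $q,s>0$, and $d\mu_{f,p,q,s}(z)=|f(z)|^p(1-|z|^2)^{q+ns}d\lambda(z)$. Then: (1) $f\in\mathcal{N}(p,q,s)$ if and only if $\mu_{f,p,q,s}$ is an $(ns)$-Carleson measure; (2) $f\in\mathcal{N}^0(p,q,s)$ if and only if $\mu_{f,p,q,s}$ is a vanishing $(ns)$-Carleson measure. Moreover, $$\|f\|^p\simeq\sup_{0<r<1,\ \xi\in\mathbb{S}}\frac{\mu_{f,p,q,s}(Q_r(\xi))}{r^{ns}}=\sup_{0<r<1,\ \xi\in\mathbb{S}}\frac{1}{r^{ns}}\int_{Q_r(\xi)}|f(z)|^p(1-|z|^2)^{q+ns}d\lambda(z),$$ where $\simeq$ means that each side is bounded by a constant, independent of $f$, times the other.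
   Context: $\mathbb{B}$ is the open unit ball of $\mathbb{C}^n$, $\mathbb{S}=\partial\mathbb{B}$, $H(\mathbb{B})$ is the space of holomorphic functions on $\mathbb{B}$, $dV$ is normalized volume measure on $\mathbb{B}$, and $d\lambda(z)=\frac{dV(z)}{(1-|z|^2)^{n+1}}$. For $a\in\mathbb{B}$, $\Phi_a(z)=\frac{a-P_az-s_aQ_az}{1-\langle z,a\rangle}$, where $s_a=\sqrt{1-|a|^2}$, $P_a$ is the orthogonal projection onto the span of $a$ and $Q_a=I-P_a$. For $p,q,s>0$ and $f\in H(\mathbb{B})$ put $\|f\|^p=\sup_{a\in\mathbb{B}}\int_{\mathbb{B}}|f(z)|^p(1-|z|^2)^q(1-|\Phi_a(z)|^2)^{ns}d\lambda(z)$; $\mathcal{N}(p,q,s)$ is the set of $f\in H(\mathbb{B})$ with $\|f\|<\infty$, and $\mathcal{N}^0(p,q,s)$ is the set of $f\in\mathcal{N}(p,q,s)$ with $\lim_{|a|\to1}\int_{\mathbb{B}}|f(z)|^p(1-|z|^2)^q(1-|\Phi_a(z)|^2)^{ns}d\lambda(z)=0$. For $\xi\in\mathbb{S}$, $r>0$, $Q_r(\xi)=\{z\in\mathbb{B}:|1-\langle z,\xi\rangle|<r\}$. For $\kappa>0$, a positive Borel measure $\mu$ on $\mathbb{B}$ is a $\kappa$-Carleson measure if there is $C>0$ with $\mu(Q_r(\xi))\le Cr^\kappa$ for all $\xi\in\mathbb{S}$, $r>0$; it is a vanishing $\kappa$-Carleson measure if in addition $\lim_{r\to0}\mu(Q_r(\xi))/r^\kappa=0$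 uniformly for $\xi\in\mathbb{S}$. *)

(* Defs.v *)
From HB Require Import structures.
From mathcomp Require Import all_boot all_order all_algebra.
From mathcomp Require Import all_classical all_reals all_analysis.
From mathcomp Require Import measurable_realfun complex.

Set Implicit Arguments.
Unset Strict Implicit.
Unset Printing Implicit Defensive.

Import Order.TTheory GRing.Theory Num.Theory.
Import numFieldNormedType.Exports.

Local Open Scope classical_set_scope.
Local Open Scope ring_scope.

(* The measure [A |-> \int[mu]_(x in A `&` D) g x] with density [g] on [D]. *)
Section density.
Local Open Scope ereal_scope.
Context d (T : measurableType d) (R : realType) (mu : {measure set T -> \bar R}).
Variables (D : set T) (g : T -> R).
Hypotheses (mD : measurable D) (mg : measurable_fun D g)
  (g0 : forall x, D x -> (0 <= g x)%R).

Definition mdensity of measurable D & measurable_fun D g &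
    (forall x, D x -> (0 <= g x)%R) :=
  fun A : set T => \int[mu]_(x in A `&` D) (g x)%:E.

Local Notation nu := (mdensity mD mg g0).

Let nu0 : nu set0 = 0.
Proof. by rewrite /mdensity set0I integral_set0. Qed.

Let nu_ge0 A : 0 <= nu A.
Proof. by apply: integral_ge0 => x [_ Dx]; rewrite lee_fin g0. Qed.

Let nu_sigma_additive : semi_sigma_additive nu.
Proof.
move=> F mF tF mUF; rewrite /mdensity setI_bigcupl ge0_integral_bigcup.
- by apply: is_cvg_ereal_nneg_natsum_cond => // n _ _; exact: nu_ge0.
- by move=> i; exact: measurableI.
- apply: (@measurable_funS _ _ _ _ D) => //; last exact/measurable_EFinP.
  by apply: bigcup_sub => i _ x [].
- by move=> x [i _ [_ Dx]]; rewrite lee_fin g0.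
- by apply: trivIset_setIr.
Qed.

HB.instance Definition _ := isMeasure.Build _ _ _ nu
  nu0 nu_ge0 nu_sigma_additive.

End density.

Section image_measure.
Local Open Scope ereal_scope.
Context d d' (T : measurableType d) (U : measurableType d') (R : realType).
Variables (m : {measure set T -> \bar R}) (f : T -> U).
Hypothesis mf : measurable_fun [set: T] f.

Definition mimage of measurable_fun [set: T] f := pushforward m f.

Let mimage0 : mimage mf set0 = 0.
Proof. exact: (measure0 (pushforward m f)). Qed.

Let mimage_ge0 A : 0 <= mimage mf A.
Proof. exact: (measure_ge0 (pushforward m f)). Qed.

Let mimage_sigma_additive : semi_sigma_additive (mimage mf).
Proof. exact: (@measure_semi_sigma_additive _ _ _ (pushforward m f)). Qed.

HB.instance Definition _ := isMeasure.Build _ _ _ (mimage mf)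
  mimage0 mimage_ge0 mimage_sigma_additive.

End image_measure.

(* The n-th power of a sigma-finite measure, on n-tuples. *)
Section tuple_measure.
Local Open Scope ereal_scope.
Context d (T : measurableType d) (R : realType).

Definition pair_cons n (p : T * n.-tuple T) : n.+1.-tuple T :=
  [tuple of p.1 :: p.2].

Lemma measurable_pair_cons n : measurable_fun [set: T * n.-tuple T] (@pair_cons n).
Proof. exact: measurable_cons. Qed.

Section step.
Variables (m : {sigma_finite_measure set T -> \bar R}) (n : nat)
  (mn : {sigma_finite_measure set (n.-tuple T) -> \bar R}).

Definition mcons : set (n.+1.-tuple T) -> \bar R :=
  mimage (m \x mn) (@measurable_pair_cons n).

HB.instance Definition _ := Measure.on mcons.

Let mcons_sigma_finite : sigma_finite setT mcons.
Proof.
have /sigma_finiteP[F [FT ndF Foo]] := sigma_finiteT m.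
have /sigma_finiteP[G [GT ndG Goo]] := sigma_finiteT mn.
pose h (t : n.+1.-tuple T) : T * n.-tuple T := (thead t, [tuple of behead t]).
have mh : measurable_fun setT h.
  by apply/measurable_fun_pair; [exact: measurable_tnth|exact: measurable_behead].
have hK p : h (pair_cons p) = p.
  by case: p => a t; congr pair => //; apply/val_inj.
exists (fun k => h @^-1` (F k `*` G k)).
  rewrite -preimage_bigcup; apply/seteqP; split => // t _.
  have [[i _ Fi] [j _ Gj]] : (\bigcup_i F i) (h t).1 /\ (\bigcup_i G i) (h t).2.
    by rewrite -FT -GT.
  exists (maxn i j) => //; split.
  - exact: (subsetPset _ _ (ndF _ _ (leq_maxl i j))).
  - exact: (subsetPset _ _ (ndG _ _ (leq_maxr i j))).
move=> k; have [mF Fk] := Foo k; have [mG Gk] := Goo k; split.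
  by rewrite -[X in measurable X]setTI; apply: mh => //; exact: measurableX.
rewrite /mcons /mimage /pushforward -comp_preimage.
rewrite (_ : h \o _ = id) ?preimage_id//; last exact/funext.
rewrite [ltLHS](_ : _ = m (F k) * mn (G k)); last exact: product_measure1E.
by rewrite lte_mul_pinfty// ge0_fin_numE.
Qed.

HB.instance Definition _ := Measure_isSigmaFinite.Build _ _ _ mcons
  mcons_sigma_finite.

End step.

Fixpoint tuple_measure (m : {sigma_finite_measure set T -> \bar R}) (n : nat) :
    {sigma_finite_measure set (n.-tuple T) -> \bar R} :=
  if n is n'.+1 then mcons m (tuple_measure m n')
  else (\d_ ([tuple] : 0.-tuple T) : {sigma_finite_measure set (0.-tuple T) -> \bar R}).

Lemma measurable_tuple_box n (A : set T) : measurable A ->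
  measurable [set t : n.-tuple T | forall i, A (tnth t i)].
Proof.
move=> mA; rewrite (_ : [set _ | _] =
    \bigcap_(i in [set: 'I_n]) (fun t : n.-tuple T => tnth t i) @^-1` A).
  apply: fin_bigcap_measurable => // i _.
  by rewrite -[X in measurable X]setTI; exact: measurable_tnth.
by apply/seteqP; split => [t tA i _|t tA i]; exact: tA.
Qed.

Lemma tuple_measure_box (m : {sigma_finite_measure set T -> \bar R}) n
    (A : set T) : measurable A ->
  tuple_measure m n [set t | forall i, A (tnth t i)] = m A ^+ n.
Proof.
move=> mA; elim: n => [|n ih].
  by rewrite /= diracE mem_set//= => -[].
rewrite expeS -ih /= /mcons /mimage /pushforward.
rewrite (_ : _ @^-1` _ = A `*` [set t | forall i, A (tnth t i)]).
  by apply: product_measure1E => //; exact: measurable_tuple_box.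
apply/seteqP; split => [[a t] /= h|[a t] /= [Aa At] i].
  by split => [|i]; [exact: (h ord0)|have := h (lift ord0 i); rewrite tnthS].
by case: (unliftP ord0 i) => [j|] ->; rewrite ?tnthS// tnth0.
Qed.

End tuple_measure.

(* [R[i]] as a normed space over itself, as the library does for abstract
   numeric fields. *)
HB.instance Definition _ (R : rcfType) := NormedModule.copy R[i] R[i]^o.

(* C^n is the type of row vectors, with its Borel sigma-algebra. *)
Definition borel_Cn_display : measure_display. Proof. exact: default_measure_display. Qed.

Section borel_Cn.
Context (R : realType) (n : nat).
Local Notation Cn := 'rV[R[i]]_n.

Let borel (A : set Cn) := <<s [set U : set Cn | open U] >> A.

Let borel0 : borel set0. Proof. exact: sigma_algebra0. Qed.

Let borelC A : borel A -> borel (~` A). Proof. exact: sigma_algebraC. Qed.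

Let borel_bigcup (F : (set Cn)^nat) :
  (forall i, borel (F i)) -> borel (\bigcup_i F i).
Proof. exact: sigma_algebra_bigcup. Qed.

HB.instance Definition _ := @isMeasurable.Build borel_Cn_display
  Cn borel borel0 borelC borel_bigcup.

Lemma open_measurable_Cn (U : set Cn) : open U -> measurable U.
Proof. by move=> oU; apply: sub_sigma_algebra. Qed.

(* The point x + i y of C^n, for (x, y) in R^n x R^n. *)
Definition Cn_of_tuple (t : (n + n).-tuple R) : Cn :=
  \row_i (tnth t (lshift n i) +i* tnth t (rshift n i))%C.

Lemma measurable_Cn_of_tuple : measurable_fun [set: (n + n).-tuple R] Cn_of_tuple.
Proof.
apply: (@measurability _ _ _ _ _ _ [set U : set Cn | open U]) => // _ [U oU <-].
rewrite setTI.
pose box (p : (n + n).-tuple rat * nat) : set ((n + n).-tuple R) :=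
  \bigcap_(i in [set: 'I_(n + n)])
    (fun t => tnth t i) @^-1` ball (ratr (tnth p.1 i) : R) (p.2.+1%:R^-1).
have mbox p : measurable (box p).
  apply: fin_bigcap_measurable => // i _.
  rewrite -[X in measurable X]setTI; apply: measurable_tnth => //.
  exact: measurable_ball.
pose F p := if `[< box p `<=` Cn_of_tuple @^-1` U >] then box p else set0.
rewrite (_ : _ @^-1` U = \bigcup_p F p).
  apply: countable_bigcupT_measurable => // p; rewrite /F.
  by case: ifP => _; [exact: mbox|exact: measurable0].
apply/seteqP; split=> [t Ut|t [p _]]; last first.
  by rewrite /F; case: asboolP => // + bt; exact.
have : nbhs (Cn_of_tuple t) U by exact: open_nbhs_nbhs.
move=> /nbhs_ballP[e e0 eU].
have [e' e'0 ee'] : exists2 e' : R, 0 < e' & e = e'%:C%C.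
  case: e e0 {eU} => a b /=; rewrite ltcE/= => /andP[/eqP b0 a0].
  by exists a => //; rewrite b0.
have [k ke] : exists k, 4 * k.+1%:R^-1 < e'.
  have [k _ /(_ k (leqnn k))] := near_infty_natSinv_lt (PosNum (divr_gt0 e'0 (ltr0n R 4))).
  by rewrite /= ltr_pdivlMr// mulrC; exists k.
have [q qt] : exists q : (n + n).-tuple rat,
    forall i, ball (ratr (tnth q i) : R) (k.+1%:R^-1) (tnth t i).
  have /choice[q qt] : forall i, exists q : rat, ball (ratr q : R) (k.+1%:R^-1) (tnth t i).
    move=> i; have := @rat_in_itvoo R (tnth t i - k.+1%:R^-1) (tnth t i + k.+1%:R^-1).
    case; first by rewrite ltrD2l gt0_cp// invr_gt0 ltr0n.
    move=> q; rewrite in_itv/= -ltr_distl => qt.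
    by exists q; rewrite /ball/=.
  by exists [tuple q i | i < n + n] => i; rewrite tnth_mktuple.
exists (q, k) => //; rewrite /F; case: asboolP => [_ i _|]; first exact: qt.
case=> t' bt'; apply: eU; split=> // i j; rewrite !mxE ee' /ball/= normc_def/= ltcR.
have h l : `|tnth t l - tnth t' l| < 2 * k.+1%:R^-1.
  have := ler_distD (ratr (tnth q l)) (tnth t l) (tnth t' l).
  move/le_lt_trans; apply; rewrite mulr_natl mulr2n ltrD//.
    by rewrite distrC; exact: qt.
  exact: bt'.
apply: lt_trans ke; apply: (@le_lt_trans _ _
    (`|tnth t (lshift n j) - tnth t' (lshift n j)| +
     `|tnth t (rshift n j) - tnth t' (rshift n j)|)).
  rewrite -[leRHS]ger0_norm ?addr_ge0// -sqrtr_sqr ler_wsqrtr//.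
  by rewrite [leRHS]sqrrD !real_normK ?num_real// lerD2r lerDl mulrn_wge0 ?mulr_ge0.
by rewrite (natrD _ 2 2) mulrDl ltrD.
Qed.

End borel_Cn.

Section unit_ball.
Context (R : realType) (n : nat).
Local Notation C := R[i].
Local Notation Cn := 'rV[R[i]]_n.
Local Notation "''[' u , v ]" := (dotmx u v) : ring_scope.
Implicit Types (z w a xi : Cn) (f : Cn -> C).

(* The library norm of R[i] takes its values in R[i]; this one is in R. *)
Definition modulus (x : C) : R := Normc.normc x.

(* The Euclidean norm of C^n; the library norm on row vectors is the sup norm. *)
Definition enorm z : R := Num.sqrt (complex.Re '[z, z]).

Definition cball : set Cn := [set z | enorm z < 1].
Definition csphere : set Cn := [set z | enorm z = 1].

Definition holomorphic_on_ball f : Prop :=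
  forall z, cball z -> differentiable f z.

Lemma modulus_continuous : continuous modulus.
Proof.
move=> x A /nbhs_ballP[e e0 eA].
apply/nbhs_ballP; exists e%:C%C => [|y xy]; first by rewrite /= ltcR.
apply: eA; rewrite /ball/= -ltcR; apply: le_lt_trans xy.
have := ler_dist_dist x y.
have -> : `|x| = (modulus x)%:C%C :> C by case: x.
have -> : `|y| = (modulus y)%:C%C :> C by case: y.
by rewrite -rmorphB/= normc_def/= expr0n/= addr0 sqrtr_sqr.
Qed.

Lemma modulus_ge0 x : 0 <= modulus x.
Proof. by case: x => a b; exact: sqrtr_ge0. Qed.

Lemma enormE z : enorm z = Num.sqrt (\sum_i modulus (z 0 i) ^+ 2).
Proof.
rewrite /enorm dotmxE mxE raddf_sum/=; congr Num.sqrt; apply: eq_bigr => i _.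
rewrite !mxE; case: (z 0 i) => a b /=.
by rewrite sqr_sqrtr ?addr_ge0 ?sqr_ge0// mulrN opprK -!expr2.
Qed.

Lemma enorm_continuous : continuous enorm.
Proof.
rewrite (_ : enorm = fun z => Num.sqrt (\sum_i modulus (z 0 i) ^+ 2)); last first.
  by apply/funext => z; exact: enormE.
move=> z; apply: continuous_comp; last exact: sqrt_continuous.
move: z; apply: continuous_big => [|i _ z]; first exact: add_continuous.
apply: (@continuous_comp _ _ _ (modulus \o (fun z : Cn => z 0 i)) (fun x => x ^+ 2)).
  apply: continuous_comp; first exact: coord_continuous.
  exact: modulus_continuous.
exact: exprn_continuous.
Qed.

Lemma cball_open : open cball.
Proof.
rewrite (_ : cball = enorm @^-1` [set x | x < 1])//.
apply: open_comp => // z _; exact: enorm_continuous.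
Qed.

Lemma measurable_cball : measurable cball.
Proof. by apply: open_measurable_Cn; exact: cball_open. Qed.

Lemma measurable_fun_cball (g : Cn -> R) :
  (forall z, cball z -> {for z, continuous g}) -> measurable_fun cball g.
Proof.
move=> cg; apply: (measurability _ (RGenOpens.measurableE R)).
move=> _ [_ [a [b ->] <-]]; apply: open_measurable_Cn.
rewrite openE => z [zB gz]; rewrite /interior.
apply: filterI; first exact: open_nbhs_nbhs (conj cball_open zB).
apply: cg => //; apply: open_nbhs_nbhs; split => //; exact: interval_open.
Qed.


Definition lebesgue_Cn : {measure set Cn -> \bar R} :=
  mimage (tuple_measure (@lebesgue_measure R) (n + n))
    (@measurable_Cn_of_tuple R n).

Lemma enorm_Cn_of_tuple t : enorm (Cn_of_tuple t) =
  Num.sqrt (\sum_(i < n + n) tnth t i ^+ 2).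
Proof.
rewrite enormE big_split_ord/= -big_split/=; congr Num.sqrt.
apply: eq_bigr => i _; rewrite mxE /modulus/=.
by rewrite sqr_sqrtr// addr_ge0 ?sqr_ge0.
Qed.

Lemma lebesgue_CnE A : lebesgue_Cn A =
  tuple_measure (@lebesgue_measure R) (n + n) (@Cn_of_tuple R n @^-1` A).
Proof. by []. Qed.

Lemma lebesgue_cball_gt0 : (0 < lebesgue_Cn cball)%E.
Proof.
pose c : R := (n + n).+1%:R^-1.
have c0 : 0 < c by rewrite invr_gt0.
pose A : set R := [set` `]- c, c[].
have mA : measurable A by exact: measurable_itv.
apply: (@lt_le_trans _ _ (tuple_measure (@lebesgue_measure R) (n + n)
    [set t | forall i, A (tnth t i)])).
  rewrite tuple_measure_box//.
  rewrite [X in (X ^+ _)%E](_ : _ = (c + c)%:E).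
    by rewrite -EFin_expe lte_fin exprn_gt0// addr_gt0.
  rewrite [LHS](lebesgue_measure_itv `]- c, c[)/= lte_fin gt0_cp//.
  by rewrite -EFinD opprK.
rewrite lebesgue_CnE; apply: le_measure; rewrite ?inE.
- exact: measurable_tuple_box.
- rewrite -[X in measurable X]setTI; apply: measurable_Cn_of_tuple => //.
  exact: measurable_cball.
move=> t /= tA; rewrite /cball/= enorm_Cn_of_tuple -sqrtr1 ltr_sqrt//.
apply: (@le_lt_trans _ _ (\sum_(i < n + n) c)).
  apply: ler_sum => i _; have := tA i; rewrite /A/= in_itv/= -ltr_norml => tc.
  rewrite -real_normK ?num_real// expr2 -[leRHS]mulr1 ler_pM// ?ltW//.
  by rewrite (lt_le_trans tc)// invf_le1// ler1n.
by rewrite sumr_const card_ord /c -[ltLHS]mulr_natl ltr_pdivrMr// mul1r ltr_nat.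
Qed.

Lemma lebesgue_cball_lty : (lebesgue_Cn cball < +oo)%E.
Proof.
pose A : set R := [set` `[- 1, 1]].
have mA : measurable A by exact: measurable_itv.
apply: (@le_lt_trans _ _ (tuple_measure (@lebesgue_measure R) (n + n)
    [set t | forall i, A (tnth t i)])).
  rewrite lebesgue_CnE; apply: le_measure; rewrite ?inE.
  - rewrite -[X in measurable X]setTI; apply: measurable_Cn_of_tuple => //.
    exact: measurable_cball.
  - exact: measurable_tuple_box.
  move=> t; rewrite /cball/= enorm_Cn_of_tuple => t1 i; rewrite /A/= in_itv/=.
  rewrite -ler_norml; apply: le_trans (ltW t1).
  rewrite -sqrtr_sqr ler_wsqrtr// (bigD1 i)//= lerDl sumr_ge0// => j _.
  exact: sqr_ge0.
rewrite tuple_measure_box//.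
rewrite [X in (X ^+ _)%E](_ : _ = (1 + 1)%:E).
  by rewrite -EFin_expe ltry.
rewrite [LHS](lebesgue_measure_itv `[- 1, 1])/= lte_fin gt0_cp//.
by rewrite -EFinD opprK.
Qed.

Let cball_normalization_ge0 : 0 <= (fine (lebesgue_Cn cball))^-1.
Proof. by rewrite invr_ge0 fine_ge0// measure_ge0. Qed.

(* Lebesgue measure, normalized so that the unit ball has measure 1. *)
Definition ball_volume : {measure set Cn -> \bar R} :=
  mscale (NngNum cball_normalization_ge0) lebesgue_Cn.

Lemma ball_volume1 : ball_volume cball = 1%E.
Proof.
rewrite /ball_volume/= /mscale/=.
have fin : lebesgue_Cn cball \is a fin_num.
  by rewrite ge0_fin_numE ?measure_ge0// lebesgue_cball_lty.
rewrite -[X in (_ * X)%E](fineK fin) -EFinM mulVf//.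
by rewrite gt_eqF// fine_gt0// lebesgue_cball_gt0 lebesgue_cball_lty.
Qed.

Lemma measurable_enorm_defect :
  measurable_fun cball (fun z => 1 - enorm z ^+ 2).
Proof.
apply: measurable_funB; first exact: measurable_cst.
apply: measurable_funX; apply: measurable_fun_cball => z _.
exact: enorm_continuous.
Qed.

Lemma enorm_defect_ge0 z : cball z -> 0 <= 1 - enorm z ^+ 2.
Proof. by move=> /ltW zB; rewrite subr_ge0 exprn_ile1// sqrtr_ge0. Qed.

Let lambda_density z : R := ((1 - enorm z ^+ 2) ^+ n.+1)^-1.

Let measurable_lambda_density : measurable_fun cball lambda_density.
Proof.
apply: (@eq_measurable_fun _ _ _ _ _
    (fun z => ((1 - enorm z ^+ 2) ^+ n.+1) `^ (-1))).
  move=> z; rewrite inE => zB.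
  by rewrite powR_inv1// exprn_ge0// enorm_defect_ge0.
apply: (measurableT_comp (measurable_powR (-1))).
by apply: measurable_funX; exact: measurable_enorm_defect.
Qed.

Let lambda_density_ge0 z : cball z -> 0 <= lambda_density z.
Proof. by move=> zB; rewrite invr_ge0 exprn_ge0// enorm_defect_ge0. Qed.

Definition lambda : {measure set Cn -> \bar R} :=
  mdensity ball_volume measurable_cball measurable_lambda_density
    lambda_density_ge0.

(* The orthogonal projections onto C a and onto its orthogonal complement;
   [proj_ortho] acts on row vectors by right multiplication. *)
Definition projP a z : Cn := z *m proj_ortho a.
Definition projQ a z : Cn := z - projP a z.

Definition Phi a z : Cn :=
  (1 - '[z, a])^-1 *:
    (a - projP a z - (Num.sqrt (1 - enorm a ^+ 2))%:C%C *: projQ a z).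

Definition carleson_tube xi (r : R) : set Cn :=
  [set z | cball z /\ modulus (1 - '[z, xi]) < r].

(* Tubes lie in the ball, so only the trace of mu on the ball matters. *)
Definition carleson (kappa : R) (mu : {measure set Cn -> \bar R}) : Prop :=
  exists2 M : R, 0 < M & forall xi r, csphere xi -> 0 < r ->
    (mu (carleson_tube xi r) <= (M * r `^ kappa)%:E)%E.

Definition vanishing_carleson (kappa : R) (mu : {measure set Cn -> \bar R}) :
    Prop :=
  carleson kappa mu /\
  forall e : R, 0 < e -> exists2 d : R, 0 < d & forall xi r,
    csphere xi -> 0 < r < d ->
    (mu (carleson_tube xi r) * ((r `^ kappa)^-1)%:E < e%:E)%E.

Section spaces.
Variables p q s : R.

Definition N_integral f a : \bar R :=
  (\int[lambda]_(z in cball)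
    (modulus (f z) `^ p * (1 - enorm z ^+ 2) `^ q *
     (1 - enorm (Phi a z) ^+ 2) `^ (n%:R * s))%:E)%E.

(* ||f||^p, possibly infinite *)
Definition N_norm_pow f : \bar R := ereal_sup [set N_integral f a | a in cball].

Definition N_space : set (Cn -> C) :=
  [set f | holomorphic_on_ball f /\ (N_norm_pow f < +oo)%E].

Definition N0_space : set (Cn -> C) :=
  [set f | N_space f /\
    forall e : R, 0 < e -> exists2 d : R, 0 < d & forall a,
      cball a -> 1 - d < enorm a -> (N_integral f a < e%:E)%E].

Let mu_density f z : R :=
  modulus (f z) `^ p * (1 - enorm z ^+ 2) `^ (q + n%:R * s).

Let measurable_mu_density f :
  holomorphic_on_ball f -> measurable_fun cball (mu_density f).
Proof.
move=> hf; apply: measurable_funM.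
  apply: (measurableT_comp (measurable_powR p)).
  apply: measurable_fun_cball => z zB; apply: continuous_comp.
    exact/differentiable_continuous/hf.
  exact: modulus_continuous.
apply: (measurableT_comp (measurable_powR (q + n%:R * s))).
exact: measurable_enorm_defect.
Qed.

Let mu_density_ge0 f z : cball z -> 0 <= mu_density f z.
Proof. by move=> _; rewrite mulr_ge0 ?powR_ge0. Qed.

Definition mu_f f (hf : holomorphic_on_ball f) : {measure set Cn -> \bar R} :=
  mdensity lambda measurable_cball (measurable_mu_density hf)
    (@mu_density_ge0 f).

End spaces.
End unit_ball.

(* Main.v *)
Require Import Defs.
From mathcomp Require Import all_boot all_order all_algebra.
From mathcomp Require Import all_classical all_reals all_analysis.
From mathcomp Require Import measurable_realfun complex.
From mathcomp Require Import ring lra.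

Set Implicit Arguments.
Unset Strict Implicit.
Unset Printing Implicit Defensive.

Import Order.TTheory GRing.Theory Num.Theory.
Import numFieldNormedType.Exports.

Local Open Scope classical_set_scope.
Local Open Scope ring_scope.

(** Why the theorem is true.

With k = n s and K_a(z) = (1 - |a|^2) / |1 - <z,a>|^2, the ball automorphism
satisfies 1 - |Phi_a(z)|^2 = (1 - |z|^2) K_a(z) ([Phi_defect]).  Hence the
integral attached to a point a in the definition of the norm of f is the
integral of K_a^k against mu_f ([N_integralE]), and everything reduces to one
fact about a measure mu on the ball: the supremum over a of the integral of
K_a^k d mu is comparable to the supremum over tubes of mu(Q_r(xi)) / r^k.

One direction tests the integral at a = (1 - r) xi, because there K_a is at
least 1 / (4 r) on all of Q_r(xi) ([kernel_tube_ge]).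

For the other direction write a = (1 - h) xi.  Then K_a <= 2 / h on the whole
ball, and K_a <= 8 h / d^2 at the points with |1 - <z,xi>| >= d.  Cutting the
ball into shells of dyadic tubes around xi, the shell of radius t has mass at
most M t^k and so contributes at most a constant times M (h / t)^k; these
contributions form a geometric series ([layer_sum]).  For the vanishing
version one stops at a small fixed radius t, where M may be taken small;
outside of that tube K_a tends to 0 uniformly as h does
([kernel_integral_le_layers]).

The supremum over tubes sees only the radii r < 1, whereas the shells reach
radius 2, so the mass of the whole ball has to be controlled by the small
tubes.  No tube with r < 1 contains the origin, but the 4 n tubes of radius 1
centred at u e_j, with u a fourth root of unity, cover the ball minus the
origin ([axis_tubes_cover]), and the origin is a null set. *)

(** * The automorphisms of the ball *)

Section dotmx_algebra.
Context (C : numClosedFieldType) (n : nat).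
Local Notation "''[' u , v ]" := (dotmx u v) : ring_scope.

(** Here [u] is the projection of [z] on the line of [a], and
[a - u - s *: (z - u)] the numerator of the automorphism at [a].  Expanding
along the orthogonal decomposition [z = c *: a + (z - u)] leaves a polynomial
identity in [c], [s], their conjugates and the norm of [z - u]. *)
Lemma ball_involution_defect (a z u : 'rV[C]_n) (c s : C) :
    u = c *: a -> '[z - u, a] = 0 -> s * s^* = 1 - '[a, a] ->
  `|1 - '[z, a]| ^+ 2 - '[a - u - s *: (z - u), a - u - s *: (z - u)] =
  (1 - '[a, a]) * (1 - '[z, z]).
Proof.
move=> ->{u}; set y := z - c *: a => ya0 sE.
have zE : z = c *: a + y by rewrite addrC subrK.
have ay0 : '[a, y] = 0 by rewrite hermC/= ya0 rmorph0 mulr0.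
have vE : a - c *: a - s *: y = (1 - c) *: a - s *: y.
  by rewrite scalerBl scale1r.
have AJ : '[a, a]^* = '[a, a] by rewrite geC0_conj// dnorm_ge0.
rewrite vE normCK; move: y ya0 ay0 zE {vE} => w wa0 aw0 ->.
rewrite !(linearBl, linearBr, linearDl, linearDr)/=.
rewrite !linearZl_LR/= !linearZr_LR/= wa0 aw0.
rewrite !(rmorphB, rmorph1, rmorphD, rmorphM, rmorph0)/= AJ.
set A := '[a, a] in sE *; set W := '[w, w].
(* linearity produces scalings in the regular module, which [ring] ignores *)
have scE (x y : C) : x *: (y : C^o) = x * y by [].
rewrite !scE.
have sE2 : A = 1 - s * s^* by rewrite sE opprB addrC subrK.
by rewrite sE2; ring.
Qed.

End dotmx_algebra.

Section complex_ball.
Context (R : realType) (n : nat).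
Local Notation Cn := 'rV[R[i]]_n.
Local Notation "''[' u , v ]" := (dotmx u v) : ring_scope.
Local Notation modulus := (@modulus R).
Implicit Types (x y : R[i]) (z w a xi : Cn).

Lemma modulusE x : (modulus x)%:C%C = `|x|.
Proof. by case: x. Qed.

Lemma modulusM x y : modulus (x * y) = modulus x * modulus y.
Proof. exact: Normc.normcM. Qed.

Lemma modulusD x y : modulus (x + y) <= modulus x + modulus y.
Proof. exact: le_normcD. Qed.

Lemma modulusN x : modulus (- x) = modulus x.
Proof. exact: normcN. Qed.

Lemma modulus_real (r : R) : modulus r%:C%C = `|r|.
Proof. by rewrite /modulus/= expr0n/= addr0 sqrtr_sqr. Qed.

Lemma modulus1 : modulus 1 = 1.
Proof. exact: Normc.normc1. Qed.

Lemma enorm_ge0 z : 0 <= enorm z.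
Proof. exact: sqrtr_ge0. Qed.

Lemma enorm_sqr z : (enorm z ^+ 2)%:C%C = '[z, z].
Proof.
rewrite enormE sqr_sqrtr; last by apply: sumr_ge0 => i _; exact: sqr_ge0.
rewrite dotmxE mxE raddf_sum/=; apply: eq_bigr => i _.
by rewrite !mxE rmorphXn/= modulusE normCK.
Qed.

Lemma cauchy_schwarz z a : modulus '[z, a] <= enorm z * enorm a.
Proof.
have h : `|'[z, a]| ^+ 2 <= '[z, z] * '[a, a].
  by have [] := CauchySchwarz (@dotmx _ n) z a.
rewrite -(ler_pXn2r (n:=2))// ?nnegrE ?mulr_ge0 ?enorm_ge0 ?modulus_ge0//.
by move: h; rewrite -modulusE -!enorm_sqr -rmorphXn -rmorphM lecR -exprMn.
Qed.

Lemma enormZ x z : enorm (x *: z) = modulus x * enorm z.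
Proof.
have h : '[x *: z, x *: z] = `|x| ^+ 2 * '[z, z].
  by rewrite linearZl_LR linearZr_LR/= normCK mulrA.
apply/eqP; rewrite -(eqrXn2 (n:=2))// ?mulr_ge0 ?enorm_ge0 ?modulus_ge0//.
move: h; rewrite -modulusE -!enorm_sqr -rmorphXn -rmorphM => /complexI ->.
by rewrite exprMn.
Qed.

Lemma enorm_0 : enorm (0 : Cn) = 0.
Proof.
by rewrite -[0 in LHS](scale0r 0) enormZ /modulus Normc.normc0 mul0r.
Qed.

Lemma modulus_dot_le z a : cball z -> modulus '[z, a] <= enorm a.
Proof.
move=> /ltW zB; apply: (le_trans (cauchy_schwarz z a)).
by rewrite -[leRHS]mul1r ler_wpM2r// enorm_ge0.
Qed.

Lemma modulus_1B_ge z a : cball z -> 1 - enorm a <= modulus (1 - '[z, a]).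
Proof.
move=> zB; have := modulus_dot_le a zB.
have := modulusD (1 - '[z, a]) '[z, a]; rewrite subrK modulus1; lra.
Qed.

Lemma modulus_1B_gt0 z a : cball z -> cball a -> 0 < modulus (1 - '[z, a]).
Proof.
by move=> zB aB; apply: lt_le_trans (modulus_1B_ge a zB); rewrite subr_gt0.
Qed.

Lemma modulus_1B_lt2 z xi : cball z -> csphere xi -> modulus (1 - '[z, xi]) < 2.
Proof.
move=> zB xi1; have := modulusD 1 (- '[z, xi]).
rewrite modulusN modulus1; have := cauchy_schwarz z xi.
by rewrite xi1 mulr1; move: zB; rewrite /cball/=; lra.
Qed.

(** The identity that turns the Moebius weight of the norm into a kernel. *)
Lemma Phi_defect a z : cball a -> cball z ->
  1 - enorm (Phi a z) ^+ 2 =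
  (1 - enorm a ^+ 2) * (1 - enorm z ^+ 2) / modulus (1 - '[z, a]) ^+ 2.
Proof.
move=> aB zB.
have den0 := modulus_1B_gt0 zB aB.
have [c Pc] : exists c : R[i], projP a z = c *: a.
  by apply/sub_rVP; exact: proj_ortho_sub.
have Qo : '[z - projP a z, a] = 0.
  have := proj_ortho_compl_sub a z.
  by rewrite orthomx1E dotmxE => /eqP ->; rewrite mxE.
set s : R[i] := (Num.sqrt (1 - enorm a ^+ 2))%:C%C.
have sE : s * s^* = 1 - '[a, a].
  rewrite -normCK -modulusE modulus_real ger0_norm ?sqrtr_ge0// -rmorphXn/=.
  by rewrite sqr_sqrtr ?enorm_defect_ge0// rmorphB/= rmorph1 enorm_sqr.
(* the identity is proved in the complex field and pulled back to the reals *)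
have descend (t u v w : R) :
    t%:C%C - u%:C%C = (1 - v%:C%C) * (1 - w%:C%C) -> t - u = (1 - v) * (1 - w).
  by move=> E; apply: complexI; rewrite rmorphB rmorphM !rmorphB rmorph1.
have := ball_involution_defect Pc Qo sE.
rewrite -!enorm_sqr -modulusE -rmorphXn => /descend h.
rewrite enormZ /modulus Normc.normcV -h exprMn exprVn mulrBl divff.
  by rewrite [X in _ - X]mulrC.
by rewrite gt_eqF// exprn_gt0.
Qed.

End complex_ball.

(** * The kernel, and its size inside and outside a tube *)

Section moebius_kernel.
Context (R : realType) (n : nat).
Local Notation Cn := 'rV[R[i]]_n.
Local Notation "''[' u , v ]" := (dotmx u v) : ring_scope.
Local Notation modulus := (@modulus R).
Implicit Types (z w a xi : Cn) (r h d : R).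

(** The factor of 1 - |Phi_a(z)|^2 other than 1 - |z|^2; for [z] on the sphere
its n-th power is the Poisson-Szego kernel. *)
Definition kernel a z : R := (1 - enorm a ^+ 2) / modulus (1 - '[z, a]) ^+ 2.

Lemma kernel_ge0 a z : cball a -> 0 <= kernel a z.
Proof.
by move=> aB; rewrite divr_ge0 ?enorm_defect_ge0// exprn_ge0// modulus_ge0.
Qed.

Lemma modulus_1B_continuous a : continuous (fun z => modulus (1 - '[z, a])).
Proof.
move=> z; apply: (@continuous_comp _ _ _ (fun w => 1 - '[w, a]) modulus);
  last exact: modulus_continuous.
rewrite (_ : (fun w => _) = fun w => 1 - \sum_j w 0 j * (a 0 j)^*); last first.
  apply/funext => w; rewrite dotmxE mxE; congr (_ - _).
  by apply: eq_bigr => j _; rewrite !mxE.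
apply: continuousB; first exact: cst_continuous.
move: z; apply: continuous_big => [|j _ z]; first exact: add_continuous.
apply: (@continuousM R[i] _ (fun w => w 0 j) (fun=> (a 0 j)^*)).
  exact: coord_continuous.
exact: cst_continuous.
Qed.

Lemma measurable_tube xi r : measurable (carleson_tube xi r).
Proof.
apply: open_measurable_Cn.
rewrite (_ : carleson_tube xi r =
   (@cball R n) `&` (fun z => modulus (1 - '[z, xi])) @^-1` [set x | x < r])//.
apply: openI; first exact: cball_open.
by apply: open_comp => // z _; exact: modulus_1B_continuous.
Qed.

Lemma measurable_kernel a : cball a -> measurable_fun (@cball R n) (kernel a).
Proof.
move=> aB; apply: measurable_fun_cball => z zB.
apply: continuousM; first exact: cst_continuous.
apply: continuousV.
  by rewrite gt_eqF// exprn_gt0// modulus_1B_gt0.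
apply: (@continuous_comp _ _ _ (fun w => modulus (1 - '[w, a]))
  (fun x => x ^+ 2)).
  exact: modulus_1B_continuous.
exact: exprn_continuous.
Qed.

(** Points of the ball are parametrized by their distance [h] to the sphere,
the scale at which the kernel changes size. *)
Definition radial xi h : Cn := (1 - h)%:C%C *: xi.

Lemma enorm_radial xi h : csphere xi -> h <= 1 -> enorm (radial xi h) = 1 - h.
Proof.
move=> xi1 h1; rewrite enormZ xi1 mulr1 modulus_real ger0_norm//.
by rewrite subr_ge0.
Qed.

Lemma cball_radial xi h : csphere xi -> 0 < h <= 1 -> cball (radial xi h).
Proof.
by move=> xi1 /andP[h0 h1]; rewrite /cball/= enorm_radial//; lra.
Qed.

Lemma enorm_delta (x : R[i]) (j : 'I_n) :
  enorm (x *: delta_mx 0 j : Cn) = modulus x.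
Proof.
rewrite enormE (bigD1 j)//= big1 => [|k kj].
  by rewrite !mxE !eqxx mulr1 addr0 sqrtr_sqr ger0_norm ?modulus_ge0.
by rewrite !mxE (negbTE kj) andbF mulr0 /modulus Normc.normc0 expr0n.
Qed.

Lemma csphere_delta (j : 'I_n) : csphere (delta_mx 0 j : Cn).
Proof.
by rewrite /csphere/= -[delta_mx _ _]scale1r enorm_delta modulus1.
Qed.

Lemma enorm0_eq0 z : enorm z = 0 -> z = 0.
Proof.
move=> z0; apply/eqP; rewrite -(dnorm_eq0 (@dotmx _ n)).
by have /esym := enorm_sqr z; rewrite z0 expr0n => /= ->.
Qed.

Lemma radial_surj a : (0 < n)%N -> cball a ->
  exists2 xi, csphere xi & a = radial xi (1 - enorm a).
Proof.
move=> n0 aB; have [a0|a0] := eqVneq (enorm a) 0.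
  exists (delta_mx 0 (Ordinal n0)); first exact: csphere_delta.
  by rewrite /radial a0 subr0 subrr scale0r; exact: enorm0_eq0.
exists ((enorm a)^-1%:C%C *: a).
  rewrite /csphere/= enormZ modulus_real ger0_norm ?invr_ge0 ?enorm_ge0//.
  by rewrite mulVf.
by rewrite /radial scalerA opprB addrC subrK -rmorphM divff// rmorph1 scale1r.
Qed.

Lemma modulus_1B_radial_ge xi h z : csphere xi -> 0 < h <= 1 -> cball z ->
  h <= modulus (1 - '[z, radial xi h]).
Proof.
move=> xi1 /andP[h0 h1] zB; have := modulus_1B_ge (radial xi h) zB.
by rewrite enorm_radial//; lra.
Qed.

(** Moving the pole from the sphere to depth [h] changes the denominator of
the kernel by at most [h], which is never more than the denominator itself. *)
Lemma dist_dot_radial xi h z : csphere xi -> 0 < h <= 1 -> cball z ->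
  modulus ('[z, xi] - '[z, radial xi h]) <= h.
Proof.
move=> xi1 /andP[h0 h1] zB.
have -> : '[z, xi] - '[z, radial xi h] = h%:C%C * '[z, xi].
  rewrite /radial linearZr_LR/= geC0_conj ?ler0c ?subr_ge0//.
  by rewrite rmorphB rmorph1 mulrBl mul1r opprB addrC subrK.
have := modulus_dot_le xi zB; rewrite xi1 modulusM modulus_real gtr0_norm//.
nra.
Qed.

(** On the tube of radius [r] both |1 - <z,xi>| and the displacement of the pole
are at most [r], so the denominator is at most 4 r^2, while the numerator
1 - (1 - r)^2 is at least [r]. *)
Lemma kernel_tube_ge xi r z : csphere xi -> 0 < r <= 1 ->
  carleson_tube xi r z -> (4 * r)^-1 <= kernel (radial xi r) z.
Proof.
move=> xi1 r01 [zB zr]; have /andP[r0 r1] := r01.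
rewrite /kernel enorm_radial//.
have key (t x y : R) : t < r -> x <= r -> r <= y -> y <= t + x ->
    (4 * r)^-1 <= (1 - (1 - r) ^+ 2) / y ^+ 2.
  move=> tr xr ry yxt.
  rewrite ler_pdivlMr ?exprn_gt0 ?(lt_le_trans r0)//.
  rewrite mulrC ler_pdivrMr ?mulr_gt0//; nra.
apply: key zr (dist_dot_radial xi1 r01 zB) (modulus_1B_radial_ge xi1 r01 zB) _.
by apply: le_trans (modulusD _ _); rewrite addrA subrK.
Qed.

Lemma kernel_le_inv xi h z : csphere xi -> 0 < h <= 1 -> cball z ->
  kernel (radial xi h) z <= 2 / h.
Proof.
move=> xi1 h01 zB; have /andP[h0 h1] := h01.
rewrite /kernel enorm_radial//.
have key (x : R) : h <= x -> (1 - (1 - h) ^+ 2) / x ^+ 2 <= 2 / h.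
  move=> hx; rewrite ler_pdivrMr ?exprn_gt0 ?(lt_le_trans h0)//.
  rewrite mulrAC ler_pdivlMr//; nra.
exact: key (modulus_1B_radial_ge xi1 h01 zB).
Qed.

(** The displacement [h] of the pole is at most the denominator, so replacing
the pole by [xi] at most doubles the latter: d <= 2 |1 - <z,a>|. *)
Lemma kernel_off_tube_le xi h d z : csphere xi -> 0 < h <= 1 -> cball z ->
  0 < d <= modulus (1 - '[z, xi]) -> kernel (radial xi h) z <= 8 * h / d ^+ 2.
Proof.
move=> xi1 h01 zB; have /andP[h0 h1] := h01.
rewrite /kernel enorm_radial//.
have key (t x y : R) : 0 < d <= t -> x <= h -> h <= y -> t <= y + x ->
    (1 - (1 - h) ^+ 2) / y ^+ 2 <= 8 * h / d ^+ 2.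
  move=> /andP[d0 dt] xh hy txy.
  rewrite ler_pdivrMr ?exprn_gt0 ?(lt_le_trans h0)//.
  rewrite mulrAC ler_pdivlMr ?exprn_gt0//.
  have : d ^+ 2 <= 4 * y ^+ 2 by nra.
  nra.
move=> dt.
have dist : modulus ('[z, radial xi h] - '[z, xi]) <= h.
  by rewrite -modulusN opprB; exact: dist_dot_radial.
apply: key dt dist (modulus_1B_radial_ge xi1 h01 zB) _.
by apply: le_trans (modulusD _ _); rewrite addrA subrK.
Qed.

End moebius_kernel.

(** * Integrals of powers of the kernel *)

Section weighted_ball.
Context (R : realType) (n : nat).
Local Notation Cn := 'rV[R[i]]_n.
Local Notation ball := (@cball R n).
Variables (nu : {measure set Cn -> \bar R}) (w : Cn -> R).
Hypotheses (mw : measurable_fun ball w) (w0 : forall z, ball z -> 0 <= w z).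
Variable k : R.
Hypothesis k0 : 0 < k.
Implicit Types (z a xi : Cn) (r h t c M : R) (A B : set Cn).

Local Notation mu := (mdensity nu (@measurable_cball R n) mw w0).

(** The integral over [A] of the [k]-th power of the kernel against the measure
with density [w]; it is written with the density, since this is the form in
which it occurs in the norm. *)
Definition kernel_integral a A : \bar R :=
  (\int[nu]_(z in A) (w z * kernel a z `^ k)%:E)%E.

Lemma tube_sub_ball xi r : carleson_tube xi r `<=` ball.
Proof. by move=> z []. Qed.

Lemma mdensity_ballE A : A `<=` ball -> mu A = (\int[nu]_(z in A) (w z)%:E)%E.
Proof. by move=> AB; rewrite /mdensity (setIidl AB). Qed.

Lemma kernel_integrand_ge0 a z : ball z -> (0 <= (w z * kernel a z `^ k)%:E)%E.
Proof. by move=> zB; rewrite lee_fin mulr_ge0 ?w0 ?powR_ge0. Qed.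

Lemma measurable_kernel_integrand a : ball a ->
  measurable_fun ball (fun z => (w z * kernel a z `^ k)%:E).
Proof.
move=> aB; apply/measurable_EFinP; apply: measurable_funM => //.
apply: (measurableT_comp (measurable_powR k)).
exact: measurable_kernel.
Qed.

Lemma measurable_weight A : A `<=` ball -> measurable_fun A (fun z => (w z)%:E).
Proof.
move=> AB; apply: (measurable_funS (@measurable_cball R n) AB).
exact/measurable_EFinP.
Qed.

Lemma kernel_integral_le a A c : ball a -> measurable A -> A `<=` ball ->
  0 <= c -> (forall z, A z -> kernel a z <= c) ->
  (kernel_integral a A <= (c `^ k)%:E * mu A)%E.
Proof.
move=> aB mA AB c0 Kc; rewrite mdensity_ballE//.
rewrite -ge0_integralZl//; first last.
- by rewrite lee_fin powR_ge0.
- by move=> z /AB zB; rewrite lee_fin w0.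
- exact: measurable_weight.
apply: ge0_le_integral => //.
- by move=> z /AB; exact: kernel_integrand_ge0.
- apply: (measurable_funS (@measurable_cball R n) AB).
  exact: measurable_kernel_integrand.
- apply: measurable_funeM; exact: measurable_weight.
- move=> z Az; rewrite -EFinM lee_fin [leRHS]mulrC; apply: ler_wpM2l.
    exact/w0/AB.
  apply: ge0_ler_powR; [exact: ltW|rewrite nnegrE; exact: kernel_ge0|by []|].
  exact: Kc.
Qed.

Lemma kernel_integral_ge a A c : ball a -> measurable A -> A `<=` ball ->
  0 <= c -> (forall z, A z -> c <= kernel a z) ->
  ((c `^ k)%:E * mu A <= kernel_integral a A)%E.
Proof.
move=> aB mA AB c0 Kc; rewrite mdensity_ballE//.
rewrite -ge0_integralZl//; first last.
- by rewrite lee_fin powR_ge0.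
- by move=> z /AB zB; rewrite lee_fin w0.
- exact: measurable_weight.
apply: ge0_le_integral => //.
- by move=> z /AB zB; rewrite -EFinM lee_fin mulr_ge0 ?powR_ge0 ?w0.
- apply: measurable_funeM; exact: measurable_weight.
- apply: (measurable_funS (@measurable_cball R n) AB).
  exact: measurable_kernel_integrand.
- move=> z Az; rewrite -EFinM lee_fin [leLHS]mulrC; apply: ler_wpM2l.
    exact/w0/AB.
  apply: ge0_ler_powR; [exact: ltW|by []|rewrite nnegrE; exact: kernel_ge0|].
  exact: Kc.
Qed.

Lemma kernel_integral_mono a A : ball a -> measurable A -> A `<=` ball ->
  (kernel_integral a A <= kernel_integral a ball)%E.
Proof.
move=> aB mA AB; apply: ge0_subset_integral => //.
- exact: measurable_cball.
- exact: measurable_kernel_integrand.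
- by move=> z; exact: kernel_integrand_ge0.
Qed.

Lemma kernel_integral_split a A B : ball a -> measurable A -> measurable B ->
  B `<=` ball -> A `<=` B ->
  kernel_integral a B = (kernel_integral a A + kernel_integral a (B `\` A))%E.
Proof.
move=> aB mA mB BB AB; rewrite /kernel_integral.
rewrite -ge0_integral_setU ?setDUK//.
- exact: measurableD.
- apply: (measurable_funS (@measurable_cball R n) BB).
  exact: measurable_kernel_integrand.
- by move=> z /BB; exact: kernel_integrand_ge0.
- by apply/disj_setPS => z [Az []].
Qed.

Lemma mu_tube_le_integral xi r : csphere xi -> 0 < r <= 1 ->
  (mu (carleson_tube xi r) <=
   ((4 * r) `^ k)%:E * kernel_integral (radial xi r) ball)%E.
Proof.
move=> xi1 r01; have /andP[r0 r1] := r01.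
have aB := cball_radial xi1 r01.
have r40 : 0 < 4 * r by rewrite mulr_gt0.
have := kernel_integral_ge aB (@measurable_tube R n xi r)
  (@tube_sub_ball xi r) _ (fun z => @kernel_tube_ge _ _ xi r z xi1 r01).
rewrite invr_ge0 ltW// => /(_ isT) h.
have {}h := le_trans h (kernel_integral_mono aB (@measurable_tube R n xi r)
  (@tube_sub_ball xi r)).
apply: (@le_trans _ _ (((4 * r) `^ k)%:E *
    (((4 * r)^-1 `^ k)%:E * mu (carleson_tube xi r)))%E).
  rewrite muleA -EFinM -powRM ?invr_ge0 ?(ltW r40)// divff ?gt_eqF// powR1.
  by rewrite mul1e.
by apply: lee_wpmul2l; rewrite ?lee_fin ?powR_ge0.
Qed.

(** Sum of the geometric series met in the decomposition into shells, with the
factor 32 ^ k of a single shell. *)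
Definition layer_const : R := 32 `^ k * (2 `^ k / (2 `^ k - 1) + 1).

Lemma powR2_gt1 : 1 < 2 `^ k.
Proof. by rewrite /powR gt_eqF// expR_gt1 mulr_gt0// ln_gt0// ltr1n. Qed.

Lemma layer_const_gt0 : 0 < layer_const.
Proof.
rewrite mulr_gt0 ?powR_gt0// ltr_wpDl// divr_ge0 ?powR_ge0//.
by rewrite subr_ge0 ltW// powR2_gt1.
Qed.

(** The shell between the tubes of radii t/2 and t has mass at most M t^k and
the kernel is at most 32 h / t^2 there, so it contributes at most
32^k M (h/t)^k.  Radii are halved until they drop below [h]; on that innermost
tube the uniform bound 2/h suffices. *)
Lemma layer_sum xi h M t : csphere xi -> 0 < h <= 1 -> 0 <= M -> h / 2 < t ->
  (forall r, 0 < r <= t -> (mu (carleson_tube xi r) <= (M * r `^ k)%:E)%E) ->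
  (kernel_integral (radial xi h) (carleson_tube xi t) <=
   (layer_const * M)%:E)%E.
Proof.
move=> xi1 h01 M0 ht Mt; have /andP[h0 h1] := h01.
have aB := cball_radial xi1 h01.
set x := 2 `^ k; set b := (x - 1)^-1.
have x1 : 1 < x.
  exact: powR2_gt1.
have b0 : 0 < b by rewrite invr_gt0 subr_gt0.
have bx : b * x = b + 1.
  by rewrite /b; field; rewrite subr_eq0 gt_eqF.
have x32 : x <= 32 `^ k.
  by apply: ge0_ler_powR; rewrite ?nnegrE ?(ltW k0)//; lra.
(* The correction [- b * (h / s) `^ k] makes the bound inductive: passing from
   [s / 2] to [s] it grows by exactly the contribution of the shell, as
   [b * x - b = 1].  The condition [h / 2 < s] keeps [(h / s) `^ k <= x], so
   that the bound is still at least [32 `^ k * M] at the innermost tube. *)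
have claim N s : h / 2 < s <= t -> s <= 2 ^+ N * h ->
    (kernel_integral (radial xi h) (carleson_tube xi s) <=
     (32 `^ k * M * (b * x + 1 - b * (h / s) `^ k))%:E)%E.
  have base s' : h / 2 < s' <= t -> s' <= h ->
      (kernel_integral (radial xi h) (carleson_tube xi s') <=
       (32 `^ k * M * (b * x + 1 - b * (h / s') `^ k))%:E)%E.
    move=> /andP[hs' s't] s'h.
    have s'0 : 0 < s' by apply: lt_trans hs'; rewrite divr_gt0.
    have s'1 : (s' / h) `^ k <= 1.
      have -> : 1 = 1 `^ k :> R by rewrite powR1.
      apply: ge0_ler_powR;
        rewrite ?nnegrE ?divr_ge0 ?(ltW h0) ?(ltW s'0) ?(ltW k0)//.
      by rewrite ler_pdivrMr// mul1r.
    have hs'x : (h / s') `^ k <= x.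
      apply: ge0_ler_powR;
        rewrite ?nnegrE ?divr_ge0 ?(ltW h0) ?(ltW s'0) ?(ltW k0)//.
      by rewrite ler_pdivrMr//; lra.
    apply: (@le_trans _ _ (((2 / h) `^ k)%:E * mu (carleson_tube xi s'))%E).
      apply: (kernel_integral_le aB).
      - exact: measurable_tube.
      - exact: tube_sub_ball.
      - by rewrite divr_ge0 ?(ltW h0).
      - by move=> z [zB _]; exact: kernel_le_inv.
    apply: (@le_trans _ _ (((2 / h) `^ k)%:E * (M * s' `^ k)%:E)%E).
      apply: lee_wpmul2l; first by rewrite lee_fin powR_ge0.
      by apply: Mt; rewrite s'0.
    rewrite -EFinM lee_fin mulrCA -powRM ?divr_ge0 ?(ltW h0) ?(ltW s'0)//.
    have -> : 2 / h * s' = 2 * (s' / h) by field; lra.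
    rewrite (@powRM _ 2) ?divr_ge0 ?(ltW h0) ?(ltW s'0)// -/x.
    apply: (@le_trans _ _ (32 `^ k * M)).
      rewrite mulrC ler_wpM2r//; apply: le_trans _ x32.
      by rewrite ler_piMr// ltW// (lt_trans ltr01).
    rewrite ler_peMr ?mulr_ge0 ?powR_ge0// addrAC lerDr -mulrBr.
    by rewrite mulr_ge0 ?(ltW b0)// subr_ge0.
  elim: N s => [|N IH] s st sN.
    by apply: base => //; rewrite -[leRHS]mul1r.
  have [|hs] := leP s h; first exact: base.
  have s0 : 0 < s by exact: lt_trans hs.
  have /andP[_ s_t] := st.
  rewrite (kernel_integral_split aB (@measurable_tube R n xi (s / 2))
    (@measurable_tube R n xi s) (@tube_sub_ball xi s)); last first.
    by move=> z [zB zs]; split=> //; apply: lt_trans zs _; lra.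
  have mD : measurable (carleson_tube xi s `\` carleson_tube xi (s / 2)).
    by apply: measurableD; exact: measurable_tube.
  have half : (kernel_integral (radial xi h) (carleson_tube xi (s / 2)) <=
     (32 `^ k * M * (b * x + 1 - b * (h / (s / 2)) `^ k))%:E)%E.
    by apply: IH; [lra|move: sN; rewrite exprS; lra].
  have shell : (kernel_integral (radial xi h)
      (carleson_tube xi s `\` carleson_tube xi (s / 2)) <=
      (32 `^ k * M * (h / s) `^ k)%:E)%E.
    apply: (@le_trans _ _ (((8 * h / (s / 2) ^+ 2) `^ k)%:E *
        mu (carleson_tube xi s `\` carleson_tube xi (s / 2)))%E).
      apply: (kernel_integral_le aB mD).
      - by move=> z [[]].
      - by rewrite divr_ge0 ?mulr_ge0 ?exprn_ge0 ?divr_ge0 ?(ltW h0) ?(ltW s0).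
      - move=> z [[zB zs] zs2]; apply: kernel_off_tube_le => //.
        rewrite divr_gt0//= leNgt.
        by apply/negP => ?; exact: zs2.
    apply: (@le_trans _ _ (((8 * h / (s / 2) ^+ 2) `^ k)%:E *
        (M * s `^ k)%:E)%E).
      apply: lee_wpmul2l; first by rewrite lee_fin powR_ge0.
      apply: le_trans (Mt s _); last by rewrite s0.
      by apply: le_measure; rewrite ?inE//; exact: measurable_tube.
    rewrite -EFinM lee_fin.
    have -> : 8 * h / (s / 2) ^+ 2 = 32 * (h / s) / s by field; lra.
    have hs0 : 0 <= h / s by rewrite divr_ge0 ?(ltW h0) ?(ltW s0).
    rewrite !powRM ?mulr_ge0 ?invr_ge0 ?(ltW s0) ?(ltW h0)//.
    have e : s^-1 `^ k * s `^ k = 1.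
      by rewrite -powRM ?invr_ge0 ?(ltW s0)// mulVf ?gt_eqF// powR1.
    rewrite le_eqVlt; apply/orP; left; apply/eqP.
    by rewrite -[RHS]mulr1 -e; ring.
  apply: (le_trans (leeD half shell)).
  rewrite -EFinD lee_fin.
  have -> : h / (s / 2) = 2 * (h / s) by field; lra.
  rewrite (@powRM _ 2) ?divr_ge0 ?(ltW h0) ?(ltW s0)// -/x.
  rewrite mulrA bx le_eqVlt; apply/orP; left; apply/eqP; ring.
have [N tN] : exists N, t <= 2 ^+ N * h.
  exists (Num.bound (t / h)); rewrite -ler_pdivrMr//.
  have th0 : 0 <= t / h by rewrite divr_ge0//; lra.
  apply: le_trans (ltW (archi_boundP th0)) _.
  by rewrite -natrX ler_nat ltnW// ltn_expl.
apply: le_trans (claim N t _ tN) _; first by rewrite ht lexx.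
rewrite lee_fin /layer_const -/x mulrAC (mulrC b x) ler_wpM2r//.
by rewrite ler_wpM2l ?powR_ge0// gerBl mulr_ge0 ?powR_ge0 ?(ltW b0).
Qed.

(** Separates the part near [xi], governed by the Carleson bound at the small
radii, from the rest of the ball, which is negligible for small [h]. *)
Lemma kernel_integral_le_layers xi h M t : csphere xi -> 0 < h <= 1 ->
  0 <= M -> h <= t ->
  (forall r, 0 < r <= t -> (mu (carleson_tube xi r) <= (M * r `^ k)%:E)%E) ->
  (kernel_integral (radial xi h) ball <=
   (layer_const * M)%:E + ((8 * h / t ^+ 2) `^ k)%:E * mu ball)%E.
Proof.
move=> xi1 h01 M0 ht Mt; have /andP[h0 h1] := h01.
have aB := cball_radial xi1 h01.
have t0 : 0 < t by exact: lt_le_trans ht.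
rewrite (kernel_integral_split aB (@measurable_tube R n xi t)
  (@measurable_cball R n) (@subset_refl _ _) (@tube_sub_ball xi t)).
have mD : measurable (ball `\` carleson_tube xi t).
  by apply: measurableD; [exact: measurable_cball|exact: measurable_tube].
apply: leeD; first by apply: layer_sum => //; lra.
apply: (@le_trans _ _ (((8 * h / t ^+ 2) `^ k)%:E *
    mu (ball `\` carleson_tube xi t))%E).
  apply: (kernel_integral_le aB mD).
  - exact: subDsetl.
  - by rewrite divr_ge0 ?mulr_ge0 ?exprn_ge0 ?(ltW h0) ?(ltW t0).
  - move=> z [zB zt]; apply: kernel_off_tube_le => //; rewrite t0/= leNgt.
    by apply/negP => ?; exact: zt.
rewrite lee_wpmul2l ?lee_fin ?powR_ge0//.
by apply: le_measure; rewrite ?inE//; exact: measurable_cball.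
Qed.

End weighted_ball.

(** * A finite cover of the punctured ball by tubes of radius one *)

Section axis_tubes.
Context (R : realType) (n : nat).
Local Notation Cn := 'rV[R[i]]_n.
Local Notation "''[' u , v ]" := (dotmx u v) : ring_scope.
Local Notation modulus := (@modulus R).
Implicit Types (z : Cn) (x u : R[i]).

Lemma dot_axis z u (j : 'I_n) : '[z, u *: delta_mx 0 j] = u^* * z 0 j.
Proof.
rewrite dotmxE mxE (bigD1 j)//= big1 => [|l lj].
  by rewrite !mxE !eqxx mulr1 addr0 mulrC.
by rewrite !mxE (negbTE lj) andbF mulr0 rmorph0 mulr0.
Qed.

Definition axis_directions : seq R[i] := [:: 1; -1; 'i%C; - 'i%C].

Lemma modulus_axis_direction u : u \in axis_directions -> modulus u = 1.
Proof.
rewrite !inE => /or4P[] /eqP ->; rewrite ?modulusN ?modulus1//;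
  by rewrite /modulus/= expr0n expr1n add0r sqrtr1.
Qed.

(** The disc of centre 1 and radius 1 contains the points of the unit disc
whose argument is at most pi/4 in absolute value, the origin excepted; the four
rotations of this sector fill the disc. *)
Lemma axis_discs_cover x : x != 0 -> modulus x < 1 ->
  exists2 u, u \in axis_directions & modulus (1 - u^* * x) < 1.
Proof.
case: x => a b ab0 ab1.
have {}ab0 : 0 < a ^+ 2 + b ^+ 2.
  rewrite lt_def addr_ge0 ?sqr_ge0// andbT paddr_eq0 ?sqr_ge0// !sqrf_eq0.
  by move: ab0; rewrite eq_complex.
have {}ab1 : a ^+ 2 + b ^+ 2 < 1.
  move: ab1; rewrite /modulus/= -[X in _ < X]sqrtr1.
  by rewrite ltr_sqrt.
have disc (c d : R) : c ^+ 2 + d ^+ 2 < 2 * c -> modulus (1 - (c +i* d)%C) < 1.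
  move=> cd; rewrite /modulus/= -[X in _ < X]sqrtr1 ltr_sqrt//; nra.
have [ba|ab] := lerP (b ^+ 2) (a ^+ 2).
  have [a0|a0] := ltrP 0 a.
    exists 1; rewrite ?inE ?eqxx// rmorph1 mul1r; apply: disc; nra.
  exists (-1); rewrite ?inE ?eqxx ?orbT// rmorphN1 mulN1r; apply: disc; nra.
have [b0|b0] := ltrP 0 b.
  exists 'i%C; rewrite ?inE ?eqxx ?orbT//.
  rewrite (_ : _ * _ = (b +i* - a)%C); last first.
    by apply/eqP; rewrite eq_complex/=; apply/andP; split; apply/eqP; ring.
  by apply: disc; nra.
exists (- 'i%C); rewrite ?inE ?eqxx ?orbT//.
rewrite (_ : _ * _ = (- b +i* a)%C); last first.
  by apply/eqP; rewrite eq_complex/=; apply/andP; split; apply/eqP; ring.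
by apply: disc; nra.
Qed.

Definition axis_points : seq Cn :=
  [seq u *: delta_mx 0 j | j <- enum 'I_n, u <- axis_directions].

Lemma axis_points_sphere xi : xi \in axis_points -> csphere xi.
Proof.
move=> /allpairsP[[j u] [_ /= uA ->]].
by rewrite /csphere/= enorm_delta modulus_axis_direction.
Qed.

Lemma axis_tubes_cover z : cball z -> z != 0 ->
  exists2 xi, xi \in axis_points & carleson_tube xi 1 z.
Proof.
move=> zB z0.
have [j zj0] : exists j, z 0 j != 0.
  apply/existsP; apply: contraNT z0; rewrite negb_exists => /forallP h.
  by apply/eqP/rowP => j; rewrite mxE; apply/eqP/negPn; exact: h.
have zj1 : modulus (z 0 j) < 1.
  have := cauchy_schwarz z (1 *: delta_mx 0 j).
  rewrite dot_axis rmorph1 mul1r enorm_delta modulus1 mulr1.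
  by move/le_lt_trans; exact.
have [u uA uz] := axis_discs_cover zj0 zj1.
exists (u *: delta_mx 0 j); last by split => //; rewrite dot_axis.
by apply/allpairsP; exists (j, u); split => //; rewrite mem_enum.
Qed.

Lemma size_axis_points : size axis_points = (n * 4)%N.
Proof. by rewrite size_allpairs size_enum_ord. Qed.

End axis_tubes.

(** * Carleson measures and the kernel *)

Section carleson_berezin.
Context (R : realType) (n : nat).
Local Notation Cn := 'rV[R[i]]_n.
Local Notation "''[' u , v ]" := (dotmx u v) : ring_scope.
Local Notation modulus := (@modulus R).
Local Notation ball := (@cball R n).
Variables (nu : {measure set Cn -> \bar R}) (w : Cn -> R).
Hypotheses (mw : measurable_fun ball w) (w0 : forall z, ball z -> 0 <= w z).
Variable k : R.
Hypothesis k0 : 0 < k.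
Hypothesis n0 : (0 < n)%N.
Local Notation mu := (mdensity nu (@measurable_cball R n) mw w0).
Hypothesis mu0 : (mu [set 0%R] = 0)%E.
Implicit Types (z a xi : Cn) (r h t c M : R) (A B : set Cn).

Lemma measurable_origin : measurable [set 0 : Cn].
Proof.
rewrite -[[set _]]setCK; apply: measurableC; apply: open_measurable_Cn.
rewrite (_ : ~` _ = @enorm R n @^-1` [set x | 0 < x]).
  by apply: open_comp => // z _; exact: enorm_continuous.
apply/seteqP; split => z /=.
  by move=> z0; rewrite lt_def enorm_ge0 andbT; apply/eqP => /enorm0_eq0.
by move=> + z0; rewrite z0 enorm_0 ltxx.
Qed.

(** The open tube of radius 1 is the increasing union of smaller tubes. *)
Lemma mu_unit_tube_le xi c :
  (forall r, 0 < r < 1 -> (mu (carleson_tube xi r) <= c%:E)%E) ->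
  (mu (carleson_tube xi 1) <= c%:E)%E.
Proof.
move=> hc.
pose rad (m : nat) : R := 1 - m.+2%:R^-1.
have rad01 m : 0 < rad m < 1.
  rewrite /rad subr_gt0 invf_lt1 ?ltr0n// ltr1n/=.
  by rewrite gtrBl invr_gt0 ltr0n.
have E : carleson_tube xi 1 = \bigcup_m carleson_tube xi (rad m).
  apply/seteqP; split => [z [zB z1]|z [m _ [zB zm]]]; last first.
    by split => //; apply: lt_trans zm _; have /andP[] := rad01 m.
  have d0 : 0 < 1 - modulus (1 - '[z, xi]) by rewrite subr_gt0.
  have [m _ /(_ m (leqnn m))] := near_infty_natSinv_lt (PosNum d0).
  rewrite /= ltrBrDl -ltrBrDr => hm; exists m => //; split => //.
  apply: lt_le_trans hm _; rewrite /rad lerD2l lerN2 lef_pV2 ?posrE ?ltr0n//.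
  by rewrite ler_nat.
rewrite E.
have mE : measurable (\bigcup_m carleson_tube xi (rad m)).
  by apply: bigcup_measurable => m _; exact: measurable_tube.
have nd : {homo (fun m => carleson_tube xi (rad m)) :
    m1 m2 / (m1 <= m2)%N >-> (m1 <= m2)%O}.
  move=> m1 m2 m12; apply/subsetPset => z [zB zm]; split => //.
  apply: lt_le_trans zm _; rewrite /rad lerD2l lerN2 lef_pV2 ?posrE ?ltr0n//.
  by rewrite ler_nat.
have cv := nondecreasing_cvg_mu (mu := mu)
  (fun m => @measurable_tube R n xi (rad m)) mE nd.
rewrite -(cvg_lim _ cv)//; apply: lime_le.
  by apply/cvg_ex; eexists; exact: cv.
by near=> m; exact: hc.
Unshelve. all: by end_near.
Qed.

Lemma mu_bigcup_seq_le (s : seq Cn) c : 0 <= c ->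
  (forall xi, xi \in s -> (mu (carleson_tube xi 1) <= c%:E)%E) ->
  (mu (\bigcup_(xi in [set` s]) carleson_tube xi 1) <= ((size s)%:R * c)%:E)%E.
Proof.
move=> c0; rewrite bigcup_seq; elim: s => [|xi s IH] hs.
  by rewrite big_nil measure0 mul0r.
rewrite big_cons /= -natr1 mulrDl mul1r addrC EFinD.
apply: le_trans (measureU2 _ _ _) _; first exact: measurable_tube.
  by apply: bigsetU_measurable => i _; exact: measurable_tube.
apply: leeD; first by apply: hs; rewrite mem_head.
by apply: IH => y ys; apply: hs; rewrite in_cons ys orbT.
Qed.

(** The small tubes control the mass of the whole ball, with a constant that
depends on the dimension only. *)
Lemma mu_ball_le c : 0 <= c ->
  (forall xi r, csphere xi -> 0 < r < 1 ->
    (mu (carleson_tube xi r) <= c%:E)%E) ->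
  (mu ball <= ((4 * n)%:R * c)%:E)%E.
Proof.
move=> c0 hc.
have m0 := measurable_origin.
have mT : measurable
    (\bigcup_(xi in [set` axis_points R n]) carleson_tube xi 1).
  rewrite bigcup_seq; apply: bigsetU_measurable => i _; exact: measurable_tube.
apply: (@le_trans _ _ (mu ([set 0] `|`
    \bigcup_(xi in [set` axis_points R n]) carleson_tube xi 1))).
  apply: le_measure; rewrite ?inE//.
  - exact: measurable_cball.
  - exact: measurableU.
  - move=> z zB; have [->|z0] := eqVneq z 0; first by left.
    by right; have [xi xiA zxi] := axis_tubes_cover zB z0; exists xi.
apply: le_trans (measureU2 _ m0 mT) _.
rewrite [X in (X + _ <= _)%E](mu0) add0e mulnC -(@size_axis_points R n).
apply: mu_bigcup_seq_le => // xi /axis_points_sphere xi1.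
by apply: mu_unit_tube_le => r r01; exact: hc.
Qed.

Lemma mu_tube_le_all_radii M : 0 <= M ->
  (forall xi r, csphere xi -> 0 < r < 1 ->
    (mu (carleson_tube xi r) <= (M * r `^ k)%:E)%E) ->
  forall xi r, csphere xi -> 0 < r ->
    (mu (carleson_tube xi r) <= ((4 * n)%:R * M * r `^ k)%:E)%E.
Proof.
move=> M0 hM xi r xi1 r0; have [r1|r1] := ltP r 1.
  apply: le_trans (hM xi r xi1 _) _; first by rewrite r0.
  rewrite lee_fin ler_wpM2r ?powR_ge0// ler_peMl// ler1n muln_gt0//.
apply: (@le_trans _ _ (mu ball)).
  apply: le_measure; rewrite ?inE.
  - exact: measurable_tube.
  - exact: measurable_cball.
  - exact: tube_sub_ball.
have hM1 zeta t : csphere zeta -> 0 < t < 1 ->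
    (mu (carleson_tube zeta t) <= M%:E)%E.
  move=> z1 t01; apply: le_trans (hM _ _ z1 t01) _; have /andP[t0 t1] := t01.
  rewrite lee_fin ler_piMr// -[leRHS](powRr0 t) ger_powR ?t0 ?ltW//.
apply: le_trans (mu_ball_le M0 hM1) _.
rewrite lee_fin ler_peMr ?mulr_ge0// -[leLHS](powRr0 r) ler_powR// ltW//.
Qed.

(** [tube_sup] and [kernel_sup] are the two quantities to be compared.  They are
kept as extended reals, infinite when the measure is not Carleson. *)
Definition tube_sup : \bar R :=
  ereal_sup [set (((r `^ k)^-1)%:E * mu (carleson_tube xi r))%E |
    r in [set r : R | 0 < r < 1] & xi in @csphere R n].

Definition kernel_sup : \bar R :=
  ereal_sup [set kernel_integral nu w k a ball | a in ball].

Lemma tube_ratio_le xi r M : 0 < r ->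
  (((r `^ k)^-1)%:E * mu (carleson_tube xi r) <= M%:E)%E =
  (mu (carleson_tube xi r) <= (M * r `^ k)%:E)%E.
Proof.
move=> r0; have rk : 0 < r `^ k by rewrite powR_gt0.
by rewrite EFinM muleC lee_pdivrMr.
Qed.

Lemma tube_sup_le M :
  (tube_sup <= M%:E)%E <->
  (forall xi r, csphere xi -> 0 < r < 1 ->
    (mu (carleson_tube xi r) <= (M * r `^ k)%:E)%E).
Proof.
split=> [SM xi r xi1 r01|hM].
  rewrite -tube_ratio_le; last by have /andP[] := r01.
  by apply: le_trans SM; apply: ereal_sup_ubound; exists r => //; exists xi.
apply: ge_ereal_sup => _ [r r01 [xi xi1 <-]].
by rewrite tube_ratio_le; [exact: hM|have /andP[] := r01].
Qed.

(** A tube of radius 2 is the whole ball, so the sum over the shells is the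
whole integral. *)
Lemma kernel_integral_le_const M a : 0 <= M ->
  (forall xi r, csphere xi -> 0 < r ->
    (mu (carleson_tube xi r) <= (M * r `^ k)%:E)%E) ->
  ball a -> (kernel_integral nu w k a ball <= (layer_const k * M)%:E)%E.
Proof.
move=> M0 hM aB; have [xi xi1 ->] := radial_surj n0 aB.
have h01 : 0 < 1 - enorm a <= 1.
  by rewrite subr_gt0 gerBl enorm_ge0 andbT.
have -> : ball = carleson_tube xi 2.
  apply/seteqP; split => z; last by case.
  by move=> zB; split => //; exact: modulus_1B_lt2.
apply: (@layer_sum R n nu w mw w0 k k0) => //.
- by have := enorm_ge0 a; lra.
- by move=> r /andP[r0 _]; exact: hM.
Qed.

Lemma mu_tube_le_of_kernel_integral M :
  (forall a, ball a -> (kernel_integral nu w k a ball <= M%:E)%E) ->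
  forall xi r, csphere xi -> 0 < r <= 1 ->
    (mu (carleson_tube xi r) <= (4 `^ k * M * r `^ k)%:E)%E.
Proof.
move=> hM xi r xi1 r01; have /andP[r0 r1] := r01.
apply: le_trans (mu_tube_le_integral nu mw w0 k0 xi1 r01) _.
rewrite mulrAC -powRM ?(ltW r0)// EFinM; apply: lee_wpmul2l.
  by rewrite lee_fin powR_ge0.
by apply: hM; exact: cball_radial.
Qed.

Lemma tube_sup_ge0 : (0 <= tube_sup)%E.
Proof.
pose xi : Cn := delta_mx 0 (Ordinal n0).
have xi1 : csphere xi by exact: csphere_delta.
have half : 0 < (2^-1 : R) < 1 by lra.
have : ((((2^-1 : R) `^ k)^-1)%:E * mu (carleson_tube xi (2^-1)) <= tube_sup)%E.
  by apply: ereal_sup_ubound; exists 2^-1 => //; exists xi.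
by apply: le_trans; rewrite mule_ge0// lee_fin invr_ge0 powR_ge0.
Qed.

Lemma kernel_sup_ge0 : (0 <= kernel_sup)%E.
Proof.
have B0 : ball 0 by rewrite /cball/= enorm_0.
apply: (@le_trans _ _ (kernel_integral nu w k 0 ball)).
  by apply: integral_ge0 => z; exact: kernel_integrand_ge0.
by apply: ereal_sup_ubound; exists 0.
Qed.

Lemma kernel_sup_le_tube_sup :
  (kernel_sup <= (layer_const k * (4 * n)%:R)%:E * tube_sup)%E.
Proof.
have lc0 := layer_const_gt0 k0.
have := tube_sup_ge0; case E : tube_sup => [M| |]//; last first.
  by rewrite gt0_muley ?leey// lte_fin mulr_gt0// ltr0n muln_gt0.
rewrite lee_fin => M0; rewrite -EFinM -mulrA.
apply: ge_ereal_sup => _ [a aB <-].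
apply: kernel_integral_le_const => //; first by rewrite mulr_ge0.
by apply: mu_tube_le_all_radii => //; apply/tube_sup_le; rewrite E.
Qed.

Lemma tube_sup_le_kernel_sup : (tube_sup <= (4 `^ k)%:E * kernel_sup)%E.
Proof.
have := kernel_sup_ge0; case E : kernel_sup => [M| |]//; last first.
  by rewrite gt0_muley ?leey// lte_fin powR_gt0.
move=> _; rewrite -EFinM; apply/tube_sup_le => xi r xi1 /andP[r0 r1].
apply: mu_tube_le_of_kernel_integral => //; last by rewrite r0 ltW.
by move=> a aB; rewrite -E; apply: ereal_sup_ubound; exists a.
Qed.

Lemma carleson_tube_sup : carleson k mu <-> (tube_sup < +oo)%E.
Proof.
split=> [[M M0 hM]|].
  apply: (@le_lt_trans _ _ M%:E); last exact: ltry.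
  by apply/tube_sup_le => xi r xi1 /andP[r0 _]; exact: hM.
have := tube_sup_ge0; case E : tube_sup => [M| |]// M0 _.
exists ((4 * n)%:R * M + 1); first by rewrite ltr_wpDl ?mulr_ge0.
move=> xi r xi1 r0; apply: le_trans (mu_tube_le_all_radii M0 _ xi1 r0) _.
  by apply/tube_sup_le; rewrite E.
by rewrite lee_fin ler_wpM2r ?powR_ge0// lerDl.
Qed.

Lemma carleson_kernel_sup : (kernel_sup < +oo)%E <-> carleson k mu.
Proof.
rewrite carleson_tube_sup; split=> h.
  apply: le_lt_trans tube_sup_le_kernel_sup _.
  by rewrite lte_mul_pinfty// ?lee_fin ?powR_ge0.
apply: le_lt_trans kernel_sup_le_tube_sup _.
by rewrite lte_mul_pinfty// lee_fin mulr_ge0// ltW// layer_const_gt0.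
Qed.

(** The kernel is tested at a = (1 - r) xi for the direct implication.  For the
converse, the tube of radius [t] contributes less than e/2 because the ratios
mu(Q_r) / r^k are small for r <= t, and the rest of the ball less than e/2
because [h] is small compared to [t ^+ 2]. *)
Lemma vanishing_carleson_kernel : carleson k mu ->
  ((forall e : R, 0 < e -> exists2 d : R, 0 < d & forall a,
      ball a -> 1 - d < enorm a -> (kernel_integral nu w k a ball < e%:E)%E) <->
   vanishing_carleson k mu).
Proof.
move=> cmu; split=> [van|[_ van] e e0].
  split => // e e0.
  have [d d0 hd] := van (e / 4 `^ k) (divr_gt0 e0 (powR_gt0 _ (ltr0n _ 4))).
  exists (Num.min d 1); first by rewrite lt_min d0 ltr01.
  move=> xi r xi1; rewrite lt_min => /and3P[r0 rd r1].
  have r01 : 0 < r <= 1 by rewrite r0 ltW.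
  rewrite lte_pdivrMr ?powR_gt0//.
  apply: le_lt_trans (mu_tube_le_integral nu mw w0 k0 xi1 r01) _.
  have r4k : 0 < (4 * r) `^ k by rewrite powR_gt0// mulr_gt0.
  rewrite -EFinM.
  have -> : e * r `^ k = (4 * r) `^ k * (e / 4 `^ k).
    rewrite powRM ?(ltW r0)//; field.
    by rewrite gt_eqF// powR_gt0.
  rewrite EFinM lte_pmul2l ?lte_fin//.
  apply: hd; first exact: cball_radial.
  by rewrite enorm_radial ?(ltW r1)// ltrD2l ltrN2.
have [M M0 hM] := cmu.
have C0 := layer_const_gt0 k0.
have eps0 : 0 < e / (2 * layer_const k) by rewrite divr_gt0// mulr_gt0.
have [d d0 hd] := van _ eps0.
pose t := d / 2.
have t0 : 0 < t by rewrite divr_gt0.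
have td : t < d by rewrite /t; lra.
clearbody t.
pose B := M * 2 `^ k.
have B0 : 0 < B by rewrite mulr_gt0// powR_gt0.
have muB : (mu ball <= B%:E)%E.
  have xi1 : csphere (delta_mx 0 (Ordinal n0) : Cn) by exact: csphere_delta.
  apply: le_trans (hM _ 2 xi1 _) => //.
  apply: le_measure; rewrite ?inE.
  - exact: measurable_cball.
  - exact: measurable_tube.
  - by move=> z zB; split => //; exact: modulus_1B_lt2.
have eB0 : 0 < e / (2 * B) by rewrite divr_gt0// mulr_gt0.
(* [g] is the value below which the [k]-th power of the kernel, multiplied by
   the mass bound [B], is less than [e / 2] *)
pose g := (e / (2 * B)) `^ k^-1.
have g0 : 0 < g by rewrite powR_gt0.
exists (Num.min t (t ^+ 2 * g / 8)).
  by rewrite lt_min t0 !mulr_gt0 ?invr_gt0 ?exprn_gt0.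
move=> a aB; have [xi xi1 ->] := radial_surj n0 aB.
have : 0 < 1 - enorm a <= 1 by rewrite subr_gt0 gerBl enorm_ge0 andbT.
move: (1 - enorm a) => h h01.
have /andP[h0 h1] := h01.
rewrite enorm_radial// ltrD2l ltrN2 lt_min => /andP[ht hg].
apply: le_lt_trans (@kernel_integral_le_layers R n nu w mw w0 k k0 xi h _ t
  xi1 h01 (ltW eps0) (ltW ht) _) _.
  move=> r /andP[r0 rt]; have := hd xi r xi1; rewrite r0 (le_lt_trans rt td).
  by move=> /(_ isT); rewrite lte_pdivrMr ?powR_gt0// => /ltW.
have small : (8 * h / t ^+ 2) `^ k < e / (2 * B).
  have -> : e / (2 * B) = g `^ k.
    by rewrite -powRrM mulVf ?gt_eqF// powRr1// ltW.
  apply: gt0_ltr_powR => //; rewrite ?nnegrE ?(ltW g0)//.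
    by rewrite divr_ge0 ?mulr_ge0 ?exprn_ge0 ?(ltW h0) ?(ltW t0).
  by rewrite ltr_pdivrMr ?exprn_gt0// mulrC [g * _]mulrC -ltr_pdivlMr.
apply: (@le_lt_trans _ _ (e / 2 + (8 * h / t ^+ 2) `^ k * B)%:E).
  rewrite EFinD (EFinM _ B); apply: leeD.
    rewrite lee_fin le_eqVlt; apply/orP; left; apply/eqP; field.
    by rewrite gt_eqF.
  by apply: lee_wpmul2l => //; rewrite lee_fin powR_ge0.
rewrite lte_fin; have : (8 * h / t ^+ 2) `^ k * B < e / 2; last by lra.
rewrite -ltr_pdivlMr//; apply: lt_le_trans small _.
by rewrite le_eqVlt; apply/orP; left; apply/eqP; field; rewrite gt_eqF.
Qed.

End carleson_berezin.

(** * The measure of a holomorphic function *)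

Lemma mdensity_null d (T : measurableType d) (R : realType)
    (nu : {measure set T -> \bar R}) (D : set T) (g : T -> R)
    (mD : measurable D) (mg : measurable_fun D g)
    (g0 : forall x, D x -> 0 <= g x) (A : set T) :
  measurable A -> nu A = 0%E -> mdensity nu mD mg g0 A = 0%E.
Proof.
move=> mA A0; rewrite /mdensity; apply: null_set_integral.
- exact: measurableI.
- apply: (measurable_funS mD (@subIsetr _ A D)).
  exact/measurable_EFinP.
- apply/eqP; rewrite -measure_le0 -A0 le_measure ?inE//.
  exact: measurableI.
Qed.

Section origin_null.
Context (R : realType) (n : nat).
Local Notation Cn := 'rV[R[i]]_n.

(** The origin is a box with one-point sides in real coordinates. *)
Lemma lebesgue_Cn_origin : (0 < n)%N -> @lebesgue_Cn R n [set 0] = 0%E.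
Proof.
move=> n0; rewrite lebesgue_CnE.
rewrite (_ : _ @^-1` _ = [set t | forall i, [set 0 : R] (tnth t i)]).
  rewrite tuple_measure_box// [X in (X ^+ _)%E](_ : _ = 0%E); last first.
    exact: lebesgue_measure_set1.
  by case: n n0 => // m _; rewrite addSn expeS mul0e.
apply/seteqP; split => t /= t0.
  move=> i; rewrite -(splitK i); case: (fintype.split i) => j /=.
    by have /matrixP/(_ 0 j) := t0; rewrite !mxE => -[].
  by have /matrixP/(_ 0 j) := t0; rewrite !mxE => -[].
by apply/rowP => j; rewrite !mxE !t0.
Qed.

Lemma mu_f_origin (p q s : R) (f : Cn -> R[i]) (hf : holomorphic_on_ball f) :
  (0 < n)%N -> mu_f p q s hf [set 0] = 0%E.
Proof.
move=> n0; have m0 := @measurable_origin R n.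
apply: mdensity_null => //; apply: mdensity_null => //.
(* the normalized volume is a multiple of Lebesgue measure by definition *)
transitivity (((fine (@lebesgue_Cn R n (@cball R n)))^-1)%:E *
  @lebesgue_Cn R n [set 0%R])%E; first by [].
by rewrite lebesgue_Cn_origin// mule0.
Qed.

Lemma N_integralE (p q s : R) (f : Cn -> R[i]) a : cball a ->
  N_integral p q s f a =
  kernel_integral (@lambda R n)
    (fun z => modulus (f z) `^ p * (1 - enorm z ^+ 2) `^ (q + n%:R * s))
    (n%:R * s) a (@cball R n).
Proof.
move=> aB; apply: eq_integral => z; rewrite inE => zB; congr EFin.
have z1 : 0 < 1 - enorm z ^+ 2.
  by rewrite subr_gt0 exprn_ilt1// ?enorm_ge0.
have key (W b A t k : R) : 0 < b -> 0 <= A -> t = b * A ->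
    W * b `^ q * t `^ k = W * b `^ (q + k) * A `^ k.
  move=> b0 A0 ->; rewrite powRM ?(ltW b0)// powRD ?(gt_eqF b0) ?implybT//.
  by rewrite !mulrA.
apply: key z1 (kernel_ge0 z aB) _.
have swap (x y c : R) : x * y / c = y * (x / c) by rewrite mulrAC mulrC.
by apply: etrans (Phi_defect aB zB) _; exact: swap.
Qed.

Lemma N_norm_powE (p q s : R) (f : Cn -> R[i]) :
  N_norm_pow p q s f = kernel_sup (@lambda R n)
    (fun z => modulus (f z) `^ p * (1 - enorm z ^+ 2) `^ (q + n%:R * s))
    (n%:R * s).
Proof.
rewrite /N_norm_pow /kernel_sup; apply: (congr1 (@ereal_sup R)).
by apply: eq_imagel => a aB; exact: N_integralE.
Qed.

End origin_null.

Theorem proposition4p1 (R : realType) (n : nat) (p q s : R)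
    (n_gt0 : (0 < n)%N) (p_ge1 : 1 <= p) (q_gt0 : 0 < q) (s_gt0 : 0 < s) :
  (forall (f : 'rV[R[i]]_n -> R[i]) (hf : holomorphic_on_ball f),
    (N_space p q s f <-> carleson (n%:R * s) (mu_f p q s hf)) /\
    (N0_space p q s f <-> vanishing_carleson (n%:R * s) (mu_f p q s hf))) /\
  (exists2 M : R, 0 < M &
    forall (f : 'rV[R[i]]_n -> R[i]) (hf : holomorphic_on_ball f),
    let S := ereal_sup [set (((r `^ (n%:R * s))^-1)%:E *
                             mu_f p q s hf (carleson_tube xi r))%E |
                        r in [set r : R | 0 < r < 1] & xi in @csphere R n] in
    [/\ (N_norm_pow p q s f <= M%:E * S)%E,
        (S <= M%:E * N_norm_pow p q s f)%E &
        S = ereal_sup [set (((r `^ (n%:R * s))^-1)%:E *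
              \int[@lambda R n]_(z in carleson_tube xi r)
                (modulus (f z) `^ p *
                 (1 - enorm z ^+ 2) `^ (q + n%:R * s))%:E)%E |
              r in [set r : R | 0 < r < 1] & xi in @csphere R n]]).
Proof.
have k0 : 0 < n%:R * s by rewrite mulr_gt0 ?ltr0n.
have NE f := @N_norm_powE R n p q s f.
split=> [f hf|].
  have mu0 := mu_f_origin p q s hf n_gt0.
  have N_carleson : N_space p q s f <-> carleson (n%:R * s) (mu_f p q s hf).
    have := carleson_kernel_sup k0 n_gt0 mu0.
    rewrite -NE => <-; split => [[]|] //.
  split=> //; rewrite /N0_space/=; split=> [[/N_carleson cf van]|vc].
    apply/(vanishing_carleson_kernel k0 n_gt0 cf) => e e0.
    have [d d0 hd] := van e e0; exists d; first exact: d0.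
    move=> a aB ad.
    by rewrite -N_integralE//; exact: hd.
  have cf : carleson (n%:R * s) (mu_f p q s hf) by case: vc.
  split; first exact/N_carleson.
  have /(vanishing_carleson_kernel k0 n_gt0 cf) van := vc.
  move=> e e0; have [d d0 hd] := van e e0; exists d; first exact: d0.
  move=> a aB ad.
  by rewrite N_integralE//; exact: hd.
have L0 : 0 < layer_const (n%:R * s) * (4 * n)%:R.
  by rewrite mulr_gt0 ?layer_const_gt0// ltr0n muln_gt0.
have F0 : 0 < 4 `^ (n%:R * s) :> R by rewrite powR_gt0.
exists (layer_const (n%:R * s) * (4 * n)%:R + 4 `^ (n%:R * s)).
  by rewrite addr_gt0.
move=> f hf S; have mu0 := mu_f_origin p q s hf n_gt0.
split.
- rewrite NE; apply: le_trans (kernel_sup_le_tube_sup k0 n_gt0 mu0) _.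
  apply: lee_wpmul2r; first exact: tube_sup_ge0.
  by rewrite lee_fin lerDl ltW.
- rewrite NE; apply: le_trans (tube_sup_le_kernel_sup _ _ _ k0) _.
  apply: lee_wpmul2r.
    by apply: kernel_sup_ge0 => z _; rewrite mulr_ge0 ?powR_ge0.
  by rewrite lee_fin lerDr ltW.
- have muE xi r : mu_f p q s hf (carleson_tube xi r) =
      (\int[@lambda R n]_(z in carleson_tube xi r)
        (modulus (f z) `^ p * (1 - enorm z ^+ 2) `^ (q + n%:R * s))%:E)%E.
    by apply: mdensity_ballE; exact: tube_sub_ball.
  apply: (congr1 (@ereal_sup R)); apply/seteqP.
  split=> _ [r r01 [xi xi1 <-]]; exists r => //; exists xi => //.
    by rewrite muE.
  by rewrite muE.
Qed.
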